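(* Let $\{x_k\}$ and the sequence of search directions $\{d_k\}$ be generated by the ASDH algorithm applied to $f(x)=\frac12\|F(x)\|^2$, and let $g_k=\nabla f(x_k)$. Then there exist positive constants $m_1,m_2$ such that for all $k=0,1,2,\dots$ $$g_k^Td_k\le -m_1\|g_k\|^2\qquad\text{and}\qquad \|d_k\|\le m_2\|g_k\|.$$
   Context: **Problem.** $F=(F_1,\dots,F_m)^T:\mathbb{R}^n\to\mathbb{R}^m$ with each $F_i:\mathbb{R}^n\to\mathbb{R}$ twice continuously differentiable; $f(x)=\frac12\|F(x)\|^2$; $J(x)\in\mathbb{R}^{m\times n}$ is the Jacobian of $F$; $g(x)=\nabla f(x)=J(x)^TF(x)$. Write $F_k=F(x_k)$, $J_k=J(x_k)$, $g_k=g(x_k)$. $\|\cdot\|$ is the Euclidean norm, and $v^i$ is the $i$th component of a vector $v$. **ASDH algorithm (Algorithm with Structured Diagonal Hessian).** Parameters: $x_0\in\mathbb{R}^n$, $\gamma,\theta\in(0,1)$, $0\le\eta_{\min}\le\eta_{\max}\le 1$, $0<l\le 1\le u<+\infty$, $\rho>0$. Initialize $H_0=I$, $Q_0=1$, $P_0=f(x_0)$. For $k=0,1,2,\dots$: 1. Direction: $d_k=-H_k^{-1}g_k$. 2. Nonmonotone line search: $\alpha_k$ is the first number $\alpha$ in the list $1,\frac12,\frac14,\dots$ for which $f(x_k+\alpha d_k)\le P_k+\theta\alpha\, g_k^Td_k$. 3. $x_{k+1}=x_k+\alpha_kd_k$ and $s_k=\alpha_kd_k=x_{k+1}-x_k$.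 4. Compute $\hat y_k=J_{k+1}^TJ_{k+1}s_k$ and $\overline y_k=(J_{k+1}-J_k)^TF_{k+1}$. Then redefine some components (safeguarding), for each $i=1,\dots,n$: - if $s_k^i>0$ and $\hat y_k^i\le 0$, replace $\hat y_k^i$ by $\gamma\max\{|(J_{k+1}^TJ_{k+1}s_k)^i|,\rho\}$; - if $s_k^i>0$ and $\overline y_k^i\le 0$, replace $\overline y_k^i$ by $\gamma\max\{|(J_{k+1}^TF_{k+1})^i|,|(J_k^TF_{k+1})^i|,\rho\}$; - if $s_k^i<0$ and $\hat y_k^i\ge 0$, replace $\hat y_k^i$ by $-\gamma\max\{(J_{k+1}^TJ_{k+1}s_k)^i,\rho\}$; - if $s_k^i<0$ and $\overline y_k^i\ge 0$, replace $\overline y_k^i$ by $-\gamma\max\{|(J_{k+1}^TF_{k+1})^i|,|(J_k^TF_{k+1})^i|,\rho\}$. 5. With $y_k=\hat y_k+\overline y_k$ (after safeguarding), let $H_{k+1}$ be the diagonal matrix with diagonal entries $h_{k+1}^i$, $i=1,\dots,n$, where $h_{k+1}^i=1$ if $s_k^i=0$, and, if $s_k^i\ne0$, $h_{k+1}^i$ equals $y_k^i/s_k^i$ if $l\le y_k^i/s_k^i\le u$, equals $l$ if $y_k^i/s_k^i<l$, and equals $u$ if $y_k^i/s_k^i>u$. 6. Choose $\eta_k\in[\eta_{\min},\eta_{\max}]$ and set $Q_{k+1}=\eta_kQ_k+1$, $P_{k+1}=\dfrac{\eta_kQ_kP_k+f(x_{k+1})}{Q_{k+1}}$. The stopping test of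 the practical algorithm is disregarded, so that infinite sequences are generated. *)

(* Defs.v *)
From mathcomp Require Import all_boot all_order all_algebra.
From mathcomp Require Import all_classical all_reals all_analysis.

Set Implicit Arguments.
Unset Strict Implicit.
Unset Printing Implicit Defensive.

Import Order.TTheory GRing.Theory Num.Theory.
Import numFieldNormedType.Exports.

Local Open Scope ring_scope.

(* Points of R^n are column vectors.  The library norm `|v| on matrices is the
   sup norm, whence a separate Euclidean norm. *)

Definition dotv (R : realType) (n : nat) (u v : 'cV[R]_n) : R :=
  (u^T *m v) 0 0.

Definition norm2 (R : realType) (n : nat) (v : 'cV[R]_n) : R :=
  Num.sqrt (\sum_i v i 0 ^+ 2).

Definition partial (R : realType) (n : nat) (j : 'I_n) (f : 'cV[R]_n -> R)
    (x : 'cV[R]_n) : R :=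
  'D_(delta_mx j 0) f x.

Definition C1 (R : realType) (n : nat) (f : 'cV[R]_n -> R) : Prop :=
  (forall x, differentiable f x) /\ (forall j, continuous (partial j f)).

Definition C2 (R : realType) (n : nat) (f : 'cV[R]_n -> R) : Prop :=
  C1 f /\ (forall j, C1 (partial j f)).

Definition grad (R : realType) (n : nat) (f : 'cV[R]_n -> R) (x : 'cV[R]_n) :
    'cV[R]_n :=
  \col_j partial j f x.

(* The library's ['J F x] is for row vectors and is the transpose of the usual
   Jacobian; here row i of [Jac F x] is the gradient of the i-th component. *)
Definition Jac (R : realType) (m n : nat) (F : 'cV[R]_n -> 'cV[R]_m)
    (x : 'cV[R]_n) : 'M[R]_(m, n) :=
  \matrix_(i, j) partial j (fun z => F z i 0) x.

Definition lsq (R : realType) (m n : nat) (F : 'cV[R]_n -> 'cV[R]_m)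
    (x : 'cV[R]_n) : R :=
  2^-1 * norm2 (F x) ^+ 2.

Lemma grad_lsq (R : realType) (m n : nat) (F : 'cV[R]_n -> 'cV[R]_m)
    (x : 'cV[R]_n) :
  (forall i, C2 (fun z => F z i 0)) -> grad (lsq F) x = (Jac F x)^T *m F x.
Proof.
move=> FC2; have -> : lsq F = \sum_i (2^-1 \*: ((fun z => F z i 0) ^+ 2)).
  apply/funext => z; rewrite /lsq /norm2 sqr_sqrtr; last first.
    by apply: sumr_ge0 => i _; exact: sqr_ge0.
  by rewrite mulr_sumr fct_sumE; apply: eq_bigr.
have dF i (j : 'I_n) : derivable (fun z => F z i 0) x (delta_mx j 0).
  by apply: diff_derivable; have [[]] := FC2 i.
apply/matrixP => j z; rewrite !mxE /partial derive_sum; last first.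
  by move=> i; apply/derivableZ/derivableX/dF.
apply: eq_bigr => i _; rewrite deriveZ; last exact/derivableX/dF.
rewrite deriveX; last exact: dF.
by rewrite !mxE (ord1 z) expr1 /GRing.scale /= -mulrA mulKf ?pnatr_eq0// mulrC.
Qed.

(* Safeguarded  yhat = J1^T J1 s. *)
Definition yhat (R : realType) (m n : nat) (gamma rho : R)
    (J1 : 'M[R]_(m, n)) (s : 'cV[R]_n) : 'cV[R]_n :=
  let w := J1^T *m J1 *m s in
  \col_i
    if (0 < s i 0) && (w i 0 <= 0) then gamma * Num.max `|w i 0| rho
    else if (s i 0 < 0) && (0 <= w i 0) then - (gamma * Num.max (w i 0) rho)
    else w i 0.

(* Safeguarded  ybar = (J1 - J0)^T F1. *)
Definition ybar (R : realType) (m n : nat) (gamma rho : R)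
    (J0 J1 : 'M[R]_(m, n)) (F1 : 'cV[R]_m) (s : 'cV[R]_n) : 'cV[R]_n :=
  let w := (J1 - J0)^T *m F1 in
  let c i := gamma * Num.max `|(J1^T *m F1) i 0|
                       (Num.max `|(J0^T *m F1) i 0| rho) in
  \col_i
    if (0 < s i 0) && (w i 0 <= 0) then c i
    else if (s i 0 < 0) && (0 <= w i 0) then - c i
    else w i 0.

Definition hess_diag (R : realType) (n : nat) (l u : R) (s y : 'cV[R]_n) :
    'M[R]_n :=
  diag_mx (\row_i
    if s i 0 == 0 then 1
    else let r := y i 0 / s i 0 in
         if r < l then l else if u < r then u else r).

(* [alpha] is the first number in the list 1, 1/2, 1/4, ... satisfying [ok]. *)
Definition first_halving (R : realType) (ok : R -> Prop) (alpha : R) : Prop :=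
  exists j : nat, [/\ alpha = 2^-1 ^+ j, ok (2^-1 ^+ j)
                    & forall i, (i < j)%N -> ~ ok (2^-1 ^+ i)].

Record asdh_params (R : realType) (gamma theta etamin etamax l u rho : R) :
    Prop := AsdhParams {
  asdh_gamma : 0 < gamma < 1;
  asdh_theta : 0 < theta < 1;
  asdh_etamin : 0 <= etamin;
  asdh_etaminmax : etamin <= etamax;
  asdh_etamax : etamax <= 1;
  asdh_l0 : 0 < l;
  asdh_l1 : l <= 1;
  asdh_u1 : 1 <= u;
  asdh_rho : 0 < rho
}.

Record asdh_run (R : realType) (m n : nat) (F : 'cV[R]_n -> 'cV[R]_m)
    (x0 : 'cV[R]_n) (gamma theta etamin etamax l u rho : R)
    (x d s : nat -> 'cV[R]_n) (alpha eta P Q : nat -> R)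
    (H : nat -> 'M[R]_n) : Prop := AsdhRun {
  asdh_x0 : x 0%N = x0;
  asdh_H0 : H 0%N = 1%:M;
  asdh_Q0 : Q 0%N = 1;
  asdh_P0 : P 0%N = lsq F x0;
  asdh_dir : forall k, d k = - (invmx (H k) *m grad (lsq F) (x k));
  asdh_search : forall k,
    first_halving
      (fun a => lsq F (x k + a *: d k)
                  <= P k + theta * a * dotv (grad (lsq F) (x k)) (d k))
      (alpha k);
  asdh_x : forall k, x k.+1 = x k + alpha k *: d k;
  asdh_s : forall k, s k = alpha k *: d k;
  asdh_H : forall k,
    H k.+1 = hess_diag l u (s k)
      (yhat gamma rho (Jac F (x k.+1)) (s k)
       + ybar gamma rho (Jac F (x k)) (Jac F (x k.+1)) (F (x k.+1)) (s k));
  asdh_eta : forall k, etamin <= eta k <= etamax;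
  asdh_Q : forall k, Q k.+1 = eta k * Q k + 1;
  asdh_P : forall k,
    P k.+1 = (eta k * Q k * P k + lsq F (x k.+1)) / Q k.+1
}.

(* Main.v *)
Require Import Defs.
From mathcomp Require Import all_boot all_order all_algebra.
From mathcomp Require Import all_classical all_reals all_analysis.

Import Order.TTheory GRing.Theory Num.Theory.
Import numFieldNormedType.Exports.

Local Open Scope ring_scope.

(** Every [H k] is diagonal with entries in [[l, u]]: the identity qualifies because [l <= 1 <= u],
    and later matrices are clamped to that interval, whatever the secant data ([hess_diag_bounds]).
    Hence [d k] has components [- g^i / h^i]. The upper bound on [h^i] gives descent with constant
    [u^-1] ([diag_direction_descent]), and the lower bound gives the norm estimate with constant
    [l^-1] ([diag_direction_norm]). Both constants are therefore uniform in [k]. *)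

Lemma norm2_ge0 (R : realType) (n : nat) (v : 'cV[R]_n) : 0 <= norm2 v.
Proof. exact: sqrtr_ge0. Qed.

Lemma sqr_norm2 (R : realType) (n : nat) (v : 'cV[R]_n) :
  norm2 v ^+ 2 = \sum_i v i 0 ^+ 2.
Proof. by rewrite sqr_sqrtr// sumr_ge0// => i _; exact: sqr_ge0. Qed.

(** The number 1 between [l] and [u] covers the default entry where [s] vanishes, and also yields
    [l <= u], so that clamping lands in the interval. *)
Lemma hess_diag_bounds (R : realType) (n : nat) (l u : R) (s y : 'cV[R]_n) :
  l <= 1 <= u ->
  exists2 h : 'rV[R]_n, hess_diag l u s y = diag_mx h
    & forall i, l <= h 0 i <= u.
Proof.
move=> /andP[l1 u1]; have lu := le_trans l1 u1.
eexists; first by [].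
move=> i; rewrite mxE; case: eqP => [_|_]; first by rewrite l1 u1.
rewrite /=; set r := y i 0 / s i 0.
case: (ltP r l) => [_|lr]; first by rewrite lexx lu.
by case: (ltP u r) => [_|ru]; rewrite ?lexx ?lu ?lr ?ru.
Qed.

Lemma invmx_diag_mulE (R : fieldType) (n : nat) (h : 'rV[R]_n) (v : 'cV[R]_n) i :
  (forall j, h 0 j != 0) -> (invmx (diag_mx h) *m v) i 0 = v i 0 / h 0 i.
Proof.
move=> h0; have hU : diag_mx h \in unitmx.
  by rewrite unitmxE det_diag unitfE; apply/prodf_neq0 => j _.
(* Expanding [v] on the right as the diagonal matrix times its inverse times [v] lets [h 0 i]
   cancel, with no formula for the inverse. *)
rewrite -[in RHS](mulKVmx hU v) mul_diag_mx !mxE.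
by rewrite mulrAC mulfV ?mul1r.
Qed.

Section DiagonalDirection.
Context (R : realType) (n : nat) (l u : R) (h : 'rV[R]_n) (g : 'cV[R]_n).
Hypotheses (l0 : 0 < l) (hb : forall i, l <= h 0 i <= u).

Let h_gt0 i : 0 < h 0 i.
Proof. by have /andP[lh _] := hb i; exact: lt_le_trans lh. Qed.

Let dE i : (- (invmx (diag_mx h) *m g)) i 0 = - (g i 0 / h 0 i).
Proof. by rewrite mxE invmx_diag_mulE// => j; rewrite gt_eqF. Qed.

(** The inner product is minus the sum of the [(g^i)^2 / h^i], and each [1 / h^i] is at least
    [u^-1]. *)
Lemma diag_direction_descent :
  dotv g (- (invmx (diag_mx h) *m g)) <= - u^-1 * norm2 g ^+ 2.
Proof.
rewrite sqr_norm2 mulr_sumr /dotv mxE ler_sum// => i _.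
rewrite dE mxE mulrN mulNr lerN2 [leRHS]mulrA -expr2 mulrC ler_wpM2l ?sqr_ge0//.
have /andP[_ hu] := hb i.
by rewrite lef_pV2// posrE// (lt_le_trans (h_gt0 i)).
Qed.

Lemma diag_direction_norm :
  norm2 (- (invmx (diag_mx h) *m g)) <= l^-1 * norm2 g.
Proof.
have lV0 : 0 <= l^-1 by rewrite invr_ge0 ltW.
(* Both sides are nonnegative, so comparing squares reduces the claim to a termwise bound on sums,
   where [1 / h^i <= l^-1]. *)
rewrite -ler_sqr ?nnegrE ?mulr_ge0 ?norm2_ge0// exprMn !sqr_norm2 mulr_sumr.
apply: ler_sum => i _; have /andP[lh _] := hb i.
rewrite dE sqrrN exprMn mulrC ler_wpM2r ?sqr_ge0//.
by rewrite ler_sqr ?nnegrE ?invr_ge0 ?(ltW l0) ?(ltW (h_gt0 i))// lef_pV2 ?posrE.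
Qed.

End DiagonalDirection.

Theorem lemma3p1 (R : realType) (m n : nat) (F : 'cV[R]_n -> 'cV[R]_m)
  (hF : forall i, C2 (fun z => F z i 0))
  (gamma theta etamin etamax l u rho : R)
  (hpar : asdh_params gamma theta etamin etamax l u rho)
  (x0 : 'cV[R]_n) (x d s : nat -> 'cV[R]_n) (alpha eta P Q : nat -> R)
  (H : nat -> 'M[R]_n)
  (hrun : asdh_run F x0 gamma theta etamin etamax l u rho
            x d s alpha eta P Q H)
  (g : nat -> 'cV[R]_n) (hg : forall k, g k = grad (lsq F) (x k)) :
  exists m1 m2 : R, [/\ 0 < m1, 0 < m2
    & forall k,
        dotv (g k) (d k) <= - m1 * norm2 (g k) ^+ 2
        /\ norm2 (d k) <= m2 * norm2 (g k)].
Proof.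
have [l0 l1 u1] : [/\ 0 < l, l <= 1 & 1 <= u] by case: hpar.
exists u^-1, l^-1; split=> [||k].
- by rewrite invr_gt0 (lt_le_trans ltr01).
- by rewrite invr_gt0.
have [h Hk hb] : exists2 h, H k = diag_mx h & forall i, l <= h 0 i <= u.
  (* The initial matrix is the identity rather than a clamped update, hence the separate case. *)
  case: k => [|k].
    exists (const_mx 1); first by rewrite (asdh_H0 hrun) diag_const_mx.
    by move=> i; rewrite mxE l1 u1.
  by rewrite (asdh_H hrun); apply: hess_diag_bounds; rewrite l1 u1.
rewrite (asdh_dir hrun) -hg Hk.
by split; [exact: diag_direction_descent hb | exact: diag_direction_norm].
Qed.
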